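(* Let $p$ be an odd prime, $q\in\mathbb{C}_p$ with $q\neq 1$ and $|q-1|_p<p^{-1/(p-1)}$, $\lambda\in\mathbb{C}_p$ with $\lambda\ne 0$, and $x\in\mathbb{C}_p$ with $|x|_p\le 1$. For every integer $n\ge 0$, $$E_{n,q}(x|\lambda)=\sum_{m=0}^n \lambda^{n-m}E_{m,q}(x)\,S_1(n,m),$$ where $S_1(n,m)$ is the (signed) Stirling number of the first kind.
   Context: $\mathbb{Z}_p$ is the ring of $p$-adic integers and $\mathbb{C}_p$ the completion of the algebraic closure of $\mathbb{Q}_p$, with $|p|_p=1/p$. For $|z|_p\le 1$, $q^z=\exp(z\log q)$ and $[z]_q=\frac{1-q^z}{1-q}$; also $[N]_{-q}=\frac{1-(-q)^N}{1+q}$ for integers $N\ge 0$. The fermionic $p$-adic $q$-integral of a continuous function $f:\mathbb{Z}_p\to\mathbb{C}_p$ is $$\int_{\mathbb{Z}_p}f(y)\,d\mu_{-q}(y)=\lim_{N\to\infty}\frac{1}{[p^N]_{-q}}\sum_{y=0}^{p^N-1}f(y)(-q)^y .$$ Carlitz's type $q$-Euler numbers $E_{n,q}$ are defined by $E_{0,q}=1$ and $q(qE_q+1)^n+E_{n,q}=0$ for $n\ge1$, where after binomial expansion $E_q^k$ is replaced by $E_{k,q}$. The $q$-Euler polynomials are $E_{n,q}(x)=\sum_{l=0}^n\binom{n}{l}q^{lx}E_{l,q}[x]_q^{n-l}$ for $n\ge0$; equivalently $E_{n,q}(x)=\int_{\mathbb{Z}_p}[x+y]_q^n\,d\mu_{-q}(y)$.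 The degenerate $q$-Euler polynomials $E_{n,q}(x|\lambda)$ are defined by the generating function $$\int_{\mathbb{Z}_p}(1+\lambda t)^{\frac{1}{\lambda}[x+y]_q}\,d\mu_{-q}(y)=\sum_{n=0}^\infty E_{n,q}(x|\lambda)\frac{t^n}{n!},$$ where $(1+\lambda t)^{z/\lambda}=\exp\left(\frac{z}{\lambda}\log(1+\lambda t)\right)$ is expanded as a power series in $t$ and the integral is taken coefficientwise. Signed Stirling numbers of the first kind: $X(X-1)\cdots(X-n+1)=\sum_{m=0}^n S_1(n,m)X^m$. *)

(* Defs.v *)
From HB Require Import structures.
From mathcomp Require Import all_boot all_order all_algebra.
(* Only the topology files: once normedtype is loaded, Hierarchy-Builder rejects
   a structure that is both a ring and a pseudometric space but not normed. *)
From mathcomp Require Import all_classical all_reals topology.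

Set Implicit Arguments.
Unset Strict Implicit.
Unset Printing Implicit Defensive.

Import Order.TTheory GRing.Theory Num.Theory.
Local Open Scope classical_set_scope.
Local Open Scope ring_scope.

(* The library's normed structures cannot be used for ultrametric fields: they
   impose `|x *+ n| = `|x| *+ n. The absolute value is therefore a separate
   function [vabs], tied to the library's pseudometric. *)
HB.mixin Record isUltrametricField (R : realType) K
    of GRing.Field K & CompletePseudoMetric R K := {
  vabs : K -> R;
  vabs_ge0 : forall x, 0 <= vabs x;
  vabs_eq0 : forall x, (vabs x == 0) = (x == 0);
  vabsM : forall x y, vabs (x * y) = vabs x * vabs y;
  vabsD_max : forall x y, vabs (x + y) <= Num.max (vabs x) (vabs y);
  ball_vabs : forall (x : K) (e : R) (y : K), ball x e y <-> vabs (x - y) < e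
}.

#[short(type="ultrametricFieldType")]
HB.structure Definition UltrametricField (R : realType) :=
  {K of GRing.Field K & CompletePseudoMetric R K & isUltrametricField R K}.

(* In a complete ultrametric field with |p| = 1/p, the closure of the prime
   subfield is the completion of the rationals for the p-adic absolute value. *)
Definition Qp_in (R : realType) (K : ultrametricFieldType R) : set K :=
  closure (range (ratr : rat -> K)).

Definition Qpbar_in (R : realType) (K : ultrametricFieldType R) : set K :=
  [set z | exists P : {poly K},
     [/\ P != 0, forall i, Qp_in (P`_i) & root P z]].

(* The field C_p, given up to isometric isomorphism as a complete field in which
   the algebraic elements over Q_p are dense and form an algebraic closure of
   Q_p. *)
HB.mixin Record isPadicComplex (R : realType) (p : nat) K
    of UltrametricField R K := {
  vabs_p : vabs (p%:R : K) = (p%:R : R)^-1;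
  Qpbar_closed : forall P : {poly K}, (forall i, Qpbar_in (P`_i)) ->
    (1 < size P)%N -> exists2 z, Qpbar_in z & root P z;
  Qpbar_dense : dense (@Qpbar_in R K)
}.

#[short(type="padicComplexType")]
HB.structure Definition PadicComplex (R : realType) (p : nat) :=
  {K of UltrametricField R K & isPadicComplex R p K}.

Section Analytic.
Variables (R : realType) (K : ultrametricFieldType R).
Implicit Types (q x z : K).

Definition vexp x : K := lim ((fun N : nat => \sum_(0 <= k < N) x ^+ k / k`!%:R) @ \oo).

Definition vlog q : K :=
  lim ((fun N : nat =>
         \sum_(0 <= k < N) (-1) ^+ k * (q - 1) ^+ k.+1 / k.+1%:R) @ \oo).

Definition qpow q z : K := vexp (z * vlog q).

Definition qnum q z : K := (1 - qpow q z) / (1 - q).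

(* [N]_{-q} *)
Definition qnumN q (N : nat) : K := (1 - (- q) ^+ N) / (1 + q).

(* The integrand is only ever evaluated at natural numbers, so it is given on
   all of K rather than on the closed subset Z_p. *)
Definition fermionic_int (p : nat) q (f : K -> K) : K :=
  lim ((fun N : nat => (qnumN q (p ^ N))^-1 *
          \sum_(0 <= y < p ^ N) f y%:R * (- q) ^+ y) @ \oo).

(* Replaces 'X^k by E k for all k: the expansion with E_q^k read as E_{k,q}. *)
Definition umbral (E : nat -> K) (P : {poly K}) : K :=
  \sum_(k < size P) P`_k * E k.

Definition is_carlitz_qEuler q (E : nat -> K) : Prop :=
  E 0%N = 1 /\
  forall n, (0 < n)%N -> q * umbral E ((q *: 'X + 1) ^+ n) + E n = 0.

(* The coefficient of E n in the n-th relation is 1 + q ^+ n.+1, which is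
   nonzero when |q - 1| < 1 and p is odd; the sequence is then unique. *)
Definition qEuler q : nat -> K := get [set E | is_carlitz_qEuler q E].

Definition qEuler_poly (n : nat) q x : K :=
  \sum_(l < n.+1) 'C(n, l)%:R * qpow q (l%:R * x) * qEuler q l *
                  qnum q x ^+ (n - l).

(* Formal power series in t are represented by their coefficient sequences. *)
Definition fps_one : nat -> K := fun n => (n == 0)%N%:R.

Definition fps_mul (u v : nat -> K) : nat -> K :=
  fun n => \sum_(i < n.+1) u i * v (n - i)%N.

(* exp (u) for u 0 = 0: only the powers u^k with k <= n contribute to t^n. *)
Definition fps_exp (u : nat -> K) : nat -> K :=
  fun n => \sum_(k < n.+1) iter k (fps_mul u) fps_one n / k`!%:R.

(* log (1 + a t) *)
Definition fps_log1 (a : K) : nat -> K :=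
  fun n => if n is m.+1 then (-1) ^+ m * a ^+ m.+1 / m.+1%:R else 0.

(* (1 + a t)^(z / a) *)
Definition degenerate_exp (a z : K) : nat -> K :=
  fps_exp (fun n => z / a * fps_log1 a n).

(* E_{n,q}(x | a): the factor n! comes from the t^n / n! normalization. *)
Definition degenerate_qEuler (p n : nat) q x (a : K) : K :=
  n`!%:R * fermionic_int p q (fun y => degenerate_exp a (qnum q (x + y)) n).

End Analytic.

Definition stirling1 (n m : nat) : int :=
  (\prod_(i < n) ('X - (i%:R)%:P) : {poly int})`_m.

(* Main.v *)
Require Import Defs.
From mathcomp Require Import all_boot all_order all_algebra.
From mathcomp Require Import all_classical all_reals all_analysis.
From mathcomp Require Import ring zify.

(* The coefficients F_n of (1 + a t)^(z/a) satisfy (n+1) F_(n+1) = (z - n a) F_n,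
   because this series solves (1 + a t) F' = z F; hence n! F_n is the product of
   the z - i a for i < n, and the Stirling numbers expand it in powers of z.
   It remains to integrate the powers of [x+y]_q = q^x [y]_q + [x]_q.  The
   integral of q^(l y) is a geometric sum, with limit (1+q)/(1+q^(l+1)), so every
   polynomial P([y]_q) is integrable and its integral is the umbral evaluation of
   P at the moments of [y]_q.  Shifting y by 1 shows that these moments satisfy
   Carlitz's recursion, whose solution is unique.
   That q^y, defined by exp and log, is the ordinary power for natural y relies
   on exp (log q) = q.  Its formal version is the case a = z = 1 of the formula
   for F_n; with r = p^(-1/(p-1)), the bounds |n!| >= r^n and |n| >= r^(n-1) show
   that the coefficient of t^n in the truncations of exp (log (1 + t)) is at most
   r^(-n), so the error terms vanish in the disc |q - 1| < r. *)

Set Implicit Arguments.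
Unset Strict Implicit.
Unset Printing Implicit Defensive.

Import Order.TTheory GRing.Theory Num.Theory.
Import numFieldNormedType.Exports.
Local Open Scope classical_set_scope.
Local Open Scope ring_scope.

(** * The truncated series exp and log *)

Section FormalSeries.
Variable K : fieldType.
Hypothesis natK : forall n, n.+1%:R != 0 :> K.
Implicit Types (P Q : {poly K}) (a z : K).

(** Truncating to polynomials gives access to derivatives, products and evaluation. [texp N P]
    agrees with exp(P) modulo X^N when P has no constant term. *)
Definition texp N P : {poly K} := \sum_(k < N) (k`!%:R)^-1 *: P ^+ k.

Definition tlog1 a N : {poly K} :=
  \poly_(i < N) (if i is j.+1 then (-1) ^+ j * a ^+ j.+1 / j.+1%:R else 0).

Lemma natr_fact_neq0 n : n`!%:R != 0 :> K.
Proof. by case: n`! (fact_gt0 n) => // m _. Qed.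

Lemma coef_expr_lt P k n : P`_0 = 0 -> (n < k)%N -> (P ^+ k)`_n = 0.
Proof.
move=> P0; have /factor_theorem[Q ->] : root P 0 by rewrite /root horner_coef0 P0.
by rewrite subr0 exprMn coefMXn => ->.
Qed.

Lemma coef_texpS N P n : P`_0 = 0 -> (n < N)%N -> (texp N.+1 P)`_n = (texp N P)`_n.
Proof.
by move=> P0 ltnN; rewrite /texp big_ord_recr /= coefD coefZ coef_expr_lt // mulr0 addr0.
Qed.

(** Differentiation shifts the exponential series by one index, so the truncation loses one term. *)
Lemma deriv_texp N P : (texp N.+1 P)^`() = P^`() * texp N P.
Proof.
rewrite /texp raddf_sum big_ord_recl /= expr0 derivZ derivC scaler0 add0r mulr_sumr.
apply: eq_bigr => i _; rewrite /bump add1n derivZ deriv_exp -scaler_nat scalerA -scalerAr.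
by rewrite factS natrM invfM mulrAC mulVf ?mul1r.
Qed.

(** The derivative is a times a geometric sum of ratio -aX, which the factor 1 + aX telescopes up to
    a remainder of order N. *)
Lemma deriv_tlog1 a N : (1 + a *: 'X) * (tlog1 a N.+1)^`() = a *: (1 - (- a *: 'X) ^+ N).
Proof.
have -> : (tlog1 a N.+1)^`() = a *: \sum_(i < N) (- a *: 'X) ^+ i.
  apply/polyP => i; rewrite coef_deriv coef_poly coefZ coef_sum ltnS.
  under eq_bigr do rewrite exprZn coefZ coefXn.
  case: ltnP => [iN|Ni]; last first.
    rewrite mul0rn big1 ?mulr0 // => j _.
    by rewrite (gtn_eqF (leq_trans (ltn_ord j) Ni)) mulr0.
  rewrite (bigD1 (Ordinal iN)) //= eqxx mulr1 big1 ?addr0; last first.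
    by move=> j /eqP ij; case: eqP => [e|]; rewrite ?mulr0 //; case: ij; apply: val_inj.
  by rewrite -(mulr_natr (_ / _)) mulfVK // exprS mulrCA -exprNn.
by rewrite -scalerAr; congr (_ *: _); rewrite scaleNr -[RHS]opprB subrX1; ring.
Qed.

(* F = texp N (z/a tlog1) solves (1 + a X) F' = z F up to order N. *)
Lemma coef_texp_tlog1 a z N n : a != 0 -> (n < N)%N ->
  (texp N (z / a *: tlog1 a N))`_n = \prod_(i < n) (z - i%:R * a) / n`!%:R.
Proof.
move=> a0; case: N => // N; set U := _ *: _; elim: n => [|n IHn] ltnN.
  rewrite big_ord0 fact0 divr1 /texp big_ord_recl coefD expr0 coefZ coef1 eqxx.
  rewrite mulr1 fact0 invr1 coef_sum big1 ?addr0 // => i _.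
  by rewrite coefZ coef_expr_lt ?mulr0 // coefZ coef_poly mulr0.
have U0 : U`_0 = 0 by rewrite coefZ coef_poly mulr0.
have E : (1 + a *: 'X) * (texp N.+1 U)^`() = z *: (1 - (- a *: 'X) ^+ N) * texp N U.
  by rewrite deriv_texp mulrA derivZ -scalerAr deriv_tlog1 scalerA mulfVK.
move: (congr1 (fun P : {poly K} => P`_n) E); rewrite mulrDl mul1r coefD coef_deriv.
rewrite -!scalerAl !coefZ coefXM mulrBl mul1r coefB.
(* Since n < N, the remainder (-aX)^N contributes nothing to the coefficient of X^n. *)
rewrite exprZn -scalerAl coefZ coefXnM (ltnN : (n < N)%N) mulr0 subr0.
rewrite -(coef_texpS (N := N)) ?IHn ?(ltnW ltnN) //.
(* The factor n absorbs the separate case n = 0. *)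
have -> : (if (n == 0)%N then 0 else ((texp N.+1 U)^`())`_n.-1)
          = n%:R * (\prod_(i < n) (z - i%:R * a) / n`!%:R).
  by case: (n) IHn ltnN => [|m] IHm ltmN; rewrite ?mul0r //= coef_deriv IHm 1?ltnW // mulr_natl.
set p := \prod_(i < n) _ => /(canRL (addrK _)) e.
rewrite big_ord_recr /= -/p; apply: (mulIf (natK n)); rewrite mulr_natr e factS natrM. field.
by rewrite natr_fact_neq0 nat1r natK.
Qed.
End FormalSeries.

(** Homogenization: the product is a^n times the falling factorial at z/a, whose integer
    coefficients are mapped into K. *)
Lemma prod_stirling1 (K : fieldType) (a z : K) n : a != 0 ->
  \prod_(i < n) (z - i%:R * a) =
  \sum_(m < n.+1) a ^+ (n - m) * z ^+ m * (stirling1 n m)%:~R.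
Proof.
move=> a0; set P : {poly int} := \prod_(i < n) ('X - (i%:R)%:P).
(* The polynomial is monic, so its degree does not drop in K. *)
have szP : size (map_poly intr P : {poly K}) = n.+1.
  rewrite size_map_poly_id0 ?size_prod_XsubC /index_enum -?enumT ?size_enum_ord //.
  by rewrite (monicP (monic_prod_XsubC _ _ _)) oner_eq0.
have hP : (map_poly intr P).[z / a] = \prod_(i < n) (z / a - i%:R).
  rewrite rmorph_prod horner_prod; apply: eq_bigr => i _.
  by rewrite /= map_polyXsubC hornerXsubC rmorph_nat.
have -> : \prod_(i < n) (z - i%:R * a) = a ^+ n * \prod_(i < n) (z / a - i%:R).
  rewrite -[n in a ^+ n]card_ord -prodr_const -big_split; apply: eq_bigr => i _ /=.
  by field.
rewrite -hP horner_coef szP mulr_sumr; apply: eq_bigr => -[m /= lemn] _.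
rewrite coef_map /= -/P -/(stirling1 n m) expr_div_n -[in a ^+ n](subnK (lemn : (m <= n)%N)) exprD.
by field; rewrite expf_neq0.
Qed.

(** * Coefficient sequences as truncated polynomials *)

Section FpsExp.
Variables (R : realType) (K : ultrametricFieldType R).
Hypothesis natK : forall n, n.+1%:R != 0 :> K.

(** The coefficients of a product below index N depend only on those of the factors below N, so
    powers can be computed on truncations. *)
Lemma iter_fps_mul (u : nat -> K) N k n : (n < N)%N ->
  iter k (fps_mul u) (@fps_one R K) n = ((\poly_(i < N) u i) ^+ k)`_n.
Proof.
elim: k n => [|k IHk] n ltnN; first by rewrite expr0 coef1.
rewrite iterS exprS coefM; apply: eq_bigr => -[i /= lein] _.
by rewrite coef_poly (leq_ltn_trans (lein : (i <= n)%N) ltnN) IHk // (leq_ltn_trans (leq_subr _ _)).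
Qed.

Lemma degenerate_expE (a z : K) n : a != 0 ->
  degenerate_exp a z n = \prod_(i < n) (z - i%:R * a) / n`!%:R.
Proof.
move=> a0; rewrite -(coef_texp_tlog1 natK z a0 (ltnSn n)) coef_sum.
apply: eq_bigr => k _; rewrite (iter_fps_mul _ _ (ltnSn n)) coefZ mulrC.
congr (_ * (polyseq (_ ^+ _))`_n); apply/polyP => i; rewrite coefZ !coef_poly.
by case: ltnP => // _; case: i => [|i] //=; rewrite mulr0.
Qed.
End FpsExp.

(** * Ultrametric limits *)

Section Ultrametric.
Variables (R : realType) (K : ultrametricFieldType R).
Implicit Types (x y z l : K) (u v : nat -> K) (C s : R).

Lemma vabs0 : vabs (0 : K) = 0.
Proof. by apply/eqP; rewrite vabs_eq0. Qed.

Lemma vabs_gt0 x : (0 < vabs x) = (x != 0).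
Proof. by rewrite lt_neqAle vabs_ge0 andbT eq_sym vabs_eq0. Qed.

Lemma vabs1 : vabs (1 : K) = 1.
Proof.
have v1 : vabs (1 : K) != 0 by rewrite vabs_eq0 oner_eq0.
by apply: (mulfI v1); rewrite -vabsM !mulr1.
Qed.

Lemma vabsX x n : vabs (x ^+ n) = vabs x ^+ n.
Proof. by elim: n => [|n IH]; rewrite ?expr0 ?vabs1 // !exprS vabsM IH. Qed.

Lemma vabsV x : vabs x^-1 = (vabs x)^-1.
Proof.
have [->|x0] := eqVneq x 0; first by rewrite invr0 vabs0 invr0.
have vx0 : vabs x != 0 by rewrite vabs_eq0.
by apply: (mulfI vx0); rewrite -vabsM !divff ?vabs1.
Qed.

Lemma vabsN x : vabs (- x) = vabs x.
Proof.
rewrite -mulN1r vabsM; suff -> : vabs (-1 : K) = 1 by rewrite mul1r.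
by apply/eqP; rewrite -(@eqrXn2 _ 2) ?vabs_ge0 // -vabsX sqrrN expr1n vabs1 expr1n.
Qed.

Lemma vabs_distC x y : vabs (x - y) = vabs (y - x).
Proof. by rewrite -vabsN opprB. Qed.

Lemma vabsD_le C x y : vabs x <= C -> vabs y <= C -> vabs (x + y) <= C.
Proof. by move=> xC yC; rewrite (le_trans (vabsD_max _ _)) // ge_max xC. Qed.

Lemma vabsD x y : vabs (x + y) <= vabs x + vabs y.
Proof. by apply: vabsD_le; rewrite ?lerDl ?lerDr ?vabs_ge0. Qed.

Lemma vabs_sum_le C (I : Type) (s : seq I) (P : pred I) (F : I -> K) :
  0 <= C -> (forall i, P i -> vabs (F i) <= C) -> vabs (\sum_(i <- s | P i) F i) <= C.
Proof.
move=> C0 FC; apply: (big_ind (fun x => vabs x <= C)) => //; first by rewrite vabs0.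
by move=> x y; exact: vabsD_le.
Qed.

Lemma vabs_nat_le1 n : vabs (n%:R : K) <= 1.
Proof. by elim: n => [|n IH]; [rewrite vabs0|rewrite -natr1 vabsD_le ?vabs1]. Qed.

(** The isosceles triangle principle: if x were smaller than y, then y = (y - x) + x would be a sum
    of two terms smaller than y. *)
Lemma vabs_dominant x y : vabs (x - y) < vabs y -> vabs x = vabs y.
Proof.
move=> xy; apply/le_anti/andP; split; first by rewrite -(subrK y x) vabsD_le // ltW.
rewrite leNgt; apply/negP => yx; have := vabsD_max (y - x) x.
by rewrite subrK leNgt gt_max yx vabs_distC xy.
Qed.

Lemma vabs_expr_sub1_le x C n : C <= 1 -> vabs (x - 1) <= C -> vabs (x ^+ n - 1) <= C.
Proof.
move=> C1 xC; have x1 : vabs x <= 1.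
  by rewrite -(subrK 1 x) vabsD_le ?vabs1 // (le_trans xC).
rewrite subrX1 vabsM -[C]mulr1 ler_pM ?vabs_ge0 ?vabs_sum_le // => i _.
by rewrite vabsX exprn_ile1 ?vabs_ge0.
Qed.

(** The cofactor of x - y is a sum of products of n - 1 factors bounded by C; the bound C^(n-1)
    appears as [C ^+ n / C]. *)
Lemma vabs_exprB_le x y C n : 0 < C -> vabs x <= C -> vabs y <= C ->
  vabs (x ^+ n - y ^+ n) <= vabs (x - y) * C ^+ n / C.
Proof.
move=> C0 xC yC; case: n => [|n]; first by rewrite !expr0 subrr vabs0 mulr1 divr_ge0 ?vabs_ge0 ?ltW.
rewrite [C ^+ _]exprSr mulrA mulfK ?gt_eqF // subrXX vabsM ler_wpM2l ?vabs_ge0 //.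
rewrite vabs_sum_le ?exprn_ge0 ?ltW // => -[i /= lein] _.
rewrite vabsM !vabsX -[in leRHS](subnK (lein : (i <= n)%N)) exprD.
by rewrite ler_pM ?exprn_ge0 ?vabs_ge0 // lerXn2r // nnegrE ?vabs_ge0 ?ltW.
Qed.

Lemma cvg_vabsP u l : (u @ \oo --> l) <-> ((fun n => vabs (u n - l)) @ \oo --> (0 : R)).
Proof.
split=> [/cvg_ballP ul|/cvgr0Pnorm_lt ul].
  apply/cvgr0Pnorm_lt => e e0; move: (ul e e0); apply: filterS => n.
  by rewrite ball_vabs vabs_distC ger0_norm // vabs_ge0.
apply/cvg_ballP => e e0; move: (ul e e0); apply: filterS => n.
by rewrite ball_vabs vabs_distC ger0_norm // vabs_ge0.
Qed.

Lemma cvg_vabs_squeeze u l (b : nat -> R) :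
  (forall n, vabs (u n - l) <= b n) -> b @ \oo --> (0 : R) -> u @ \oo --> l.
Proof.
move=> ub b0; apply/cvg_vabsP; apply: squeeze_cvgr (@cvg_cst _ _ _ _ _) b0.
by apply: nearW => n; rewrite vabs_ge0 ub.
Qed.

(** The balls of radius |x - y| around x and y are already disjoint, by the ultrametric
    inequality. *)
Lemma vhausdorff : hausdorff_space K.
Proof.
rewrite ball_hausdorff => x y xy.
have e0 : 0 < vabs (x - y) by rewrite vabs_gt0 subr_eq0.
exists (PosNum e0, PosNum e0); apply/eqP; rewrite -subset0 => z /= [].
rewrite !ball_vabs => xz yz; have := vabsD_max (x - z) (z - y).
by rewrite addrA subrK leNgt gt_max xz vabs_distC yz.
Qed.

Lemma vcvg_lim u l : u @ \oo --> l -> lim (u @ \oo) = l.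
Proof. by move=> ul; apply/cvg_lim => //; exact: vhausdorff. Qed.

Lemma vcvg_unique u l l' : u @ \oo --> l -> u @ \oo --> l' -> l = l'.
Proof. by move=> /vcvg_lim <- /vcvg_lim <-. Qed.

Lemma vcvg_ext u v l : u =1 v -> u @ \oo --> l -> v @ \oo --> l.
Proof. by move=> /funext ->. Qed.

Lemma vcvgD u v l l' : u @ \oo --> l -> v @ \oo --> l' -> (fun n => u n + v n) @ \oo --> l + l'.
Proof.
move=> /cvg_vabsP ul /cvg_vabsP vl.
apply: (@cvg_vabs_squeeze _ _ (fun n => vabs (u n - l) + vabs (v n - l'))).
  by move=> n; rewrite opprD addrACA vabsD.
by rewrite -[0]addr0; apply: cvgD.
Qed.

Lemma vcvgM u v l l' : u @ \oo --> l -> v @ \oo --> l' -> (fun n => u n * v n) @ \oo --> l * l'.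
Proof.
move=> /cvg_vabsP ul /cvg_vabsP vl.
apply: (@cvg_vabs_squeeze _ _ (fun n => vabs (u n - l) * vabs (v n - l') +
   vabs (u n - l) * vabs l' + vabs l * vabs (v n - l'))).
  move=> n; rewrite -!vabsM.
  have -> : u n * v n - l * l' = (u n - l) * (v n - l') + (u n - l) * l' + l * (v n - l') by ring.
  by rewrite (le_trans (vabsD _ _)) // lerD2r vabsD.
have -> : 0 = 0 * 0 + 0 * vabs l' + vabs l * 0 by ring.
by apply: cvgD; [apply: cvgD; [exact: cvgM|exact: cvgMl]|exact: cvgMr].
Qed.

Lemma vcvg_sum (I : Type) (s : seq I) (P : pred I) (F : I -> nat -> K) (l : I -> K) :
  (forall i, P i -> F i @ \oo --> l i) ->
  (fun n => \sum_(i <- s | P i) F i n) @ \oo --> \sum_(i <- s | P i) l i.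
Proof.
move=> Fl; elim: s => [|i s IH].
  rewrite big_nil; under eq_fun do rewrite big_nil; exact: cvg_cst.
rewrite big_cons; under eq_fun do rewrite big_cons; case: ifP => // Pi.
by apply: vcvgD => //; exact: Fl.
Qed.

(** Eventually |u n| = |l|, so the inverses differ by exactly |u n - l| / |l|^2. *)
Lemma vcvgV u l : l != 0 -> u @ \oo --> l -> (fun n => (u n)^-1) @ \oo --> l^-1.
Proof.
move=> l0 /cvg_vabsP ul; have vl0 : 0 < vabs l by rewrite vabs_gt0.
apply/cvg_vabsP.
apply: (@squeeze_cvgr _ _ _ _ (fun=> 0) (fun n => vabs (u n - l) * ((vabs l) ^- 2))).
- move/cvgr0Pnorm_lt : ul => /(_ _ vl0); apply: filterS => n.
  rewrite vabs_ge0 ger0_norm ?vabs_ge0 //= => /vabs_dominant un.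
  have un0 : u n != 0 by rewrite -vabs_gt0 un.
  have -> : (u n)^-1 - l^-1 = (l - u n) * ((u n)^-1 * l^-1) by field; rewrite ?un0 ?l0.
  by rewrite !vabsM !vabsV vabs_distC un expr2 invfM.
- exact: cvg_cst.
by rewrite -[0](mul0r (vabs l ^- 2)); exact: cvgMl.
Qed.

Lemma vabs_lim_le u l C : u @ \oo --> l -> (forall n, vabs (u n) <= C) -> vabs l <= C.
Proof.
move=> /cvg_vabsP/cvgr0Pnorm_lt ul uC; rewrite leNgt; apply/negP => Cl.
have C0 : 0 <= C by rewrite (le_trans _ (uC 0%N)) ?vabs_ge0.
have [N _ /(_ N (leqnn N))] := ul _ (le_lt_trans C0 Cl).
rewrite /= ger0_norm ?vabs_ge0 // => /vabs_dominant ulN.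
by move: (uC N); rewrite ulN leNgt Cl.
Qed.

Lemma cvg_geo (s : R) : 0 <= s < 1 -> (fun n => s ^+ n) @ \oo --> (0 : R).
Proof. by case/andP=> s0 s1; apply: cvg_expr; rewrite ger0_norm. Qed.

(** A block of terms starting at N is bounded by its largest bound C s^N, so the partial sums are
    Cauchy. *)
Lemma is_cvg_vseries (c : nat -> K) C s : 0 <= s < 1 -> (forall k, vabs (c k) <= C * s ^+ k) ->
  cvg ((fun N => \sum_(0 <= k < N) c k) @ \oo).
Proof.
move=> /andP[s0 s1] cC; apply: (@cauchy_cvg K); apply/cauchy_exP => e e0.
have : (fun n => C * s ^+ n) @ \oo --> (0 : R).
  by rewrite -(mulr0 C); apply: cvgMr; apply: cvg_expr; rewrite ger0_norm.
move/cvgr0Pnorm_lt => /(_ _ e0)[N _ CsN].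
exists (\sum_(0 <= k < N) c k); exists N => // n /= leNn.
rewrite ball_vabs vabs_distC (big_cat_nat (leq0n N) leNn) /= addrAC subrr add0r.
apply: le_lt_trans (CsN N (leqnn N)); rewrite ger0_norm; last first.
  by rewrite (le_trans _ (cC N)) ?vabs_ge0.
rewrite big_seq vabs_sum_le // => [|k].
  by rewrite (le_trans _ (cC N)) ?vabs_ge0.
rewrite mem_index_iota => /andP[leNk _]; apply: le_trans (cC k) _.
have C0 : 0 <= C by move: (cC 0%N); rewrite expr0 mulr1; apply: le_trans; rewrite vabs_ge0.
by rewrite ler_wpM2l // ler_wiXn2l // ltW.
Qed.

(** Submultiplicativity of the Gauss norm with weights s^i. *)
Lemma vabs_coefM_le (P Q : {poly K}) s (A B : R) n : 0 <= s -> 0 <= A -> 0 <= B ->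
  (forall i, vabs (P`_i) <= A * s ^+ i) -> (forall i, vabs (Q`_i) <= B * s ^+ i) ->
  vabs ((P * Q)`_n) <= A * B * s ^+ n.
Proof.
move=> s0 A0 B0 PA QB; rewrite coefM vabs_sum_le ?mulr_ge0 ?exprn_ge0 // => -[i /= lein] _.
rewrite vabsM -[in leRHS](subnKC (lein : (i <= n)%N)) exprD mulrACA.
by rewrite ler_pM ?vabs_ge0.
Qed.

(** The bound does not involve the degree of P, so it applies uniformly to a sequence of
    truncations. *)
Lemma vabs_horner_tail (P : {poly K}) s w N : 0 <= s -> s * vabs w <= 1 ->
  (forall i, vabs (P`_i) <= s ^+ i) ->
  vabs (P.[w] - \sum_(i < N) P`_i * w ^+ i) <= (s * vabs w) ^+ N.
Proof.
move=> s0 sw1 Ps; have sw0 : 0 <= s * vabs w by rewrite mulr_ge0 ?vabs_ge0.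
(* Padding to [N + size P] terms lets the sum split at N even when N exceeds the size of P. *)
rewrite (@horner_coef_wide _ (N + size P)) ?leq_addl // big_split_ord /= addrAC subrr add0r.
rewrite vabs_sum_le ?exprn_ge0 // => i _; rewrite vabsM vabsX.
rewrite (@le_trans _ _ ((s * vabs w) ^+ (N + i))) //.
  by rewrite exprMn ler_wpM2r ?exprn_ge0 ?vabs_ge0.
by rewrite ler_wiXn2l ?leq_addr.
Qed.
End Ultrametric.

(** * Exponential and logarithm *)

Section ExpLog.
Variables (R : realType) (K : ultrametricFieldType R) (r : R).
Hypothesis r_gt0 : 0 < r.
(** These two bounds are what the section knows about the p-adic valuation; they are later supplied
    for r = p^(-1/(p-1)). *)
Hypothesis vabs_nat_ge : forall n, r ^+ n <= vabs (n.+1%:R : K).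
Hypothesis vabs_fact_ge : forall n, r ^+ n <= vabs (n`!%:R : K).
Implicit Types x y q w : K.

Lemma natS_neq0 n : n.+1%:R != 0 :> K.
Proof. by rewrite -vabs_gt0 (lt_le_trans _ (vabs_nat_ge n)) ?exprn_gt0. Qed.

Lemma vabs_exp_term_le x C k : vabs x <= C -> vabs (x ^+ k / k`!%:R) <= (C / r) ^+ k.
Proof.
move=> xC; rewrite vabsM vabsV vabsX expr_div_n.
have C0 : 0 <= C by rewrite (le_trans _ xC) ?vabs_ge0.
apply: ler_pM; rewrite ?invr_ge0 ?exprn_ge0 ?vabs_ge0 //.
  by rewrite lerXn2r ?nnegrE ?vabs_ge0.
by rewrite lef_pV2 ?vabs_fact_ge // posrE ?exprn_gt0 // (lt_le_trans _ (vabs_fact_ge k)) ?exprn_gt0.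
Qed.

Lemma divr_in01 (a : R) : 0 <= a -> a < r -> 0 <= a / r < 1.
Proof. by move=> a0 ar; rewrite divr_ge0 ?(ltW r_gt0) //= ltr_pdivrMr // mul1r. Qed.

Lemma cvg_vexp x : vabs x < r ->
  (fun N => \sum_(k < N) x ^+ k / k`!%:R) @ \oo --> vexp x.
Proof.
move=> xr; under eq_fun do rewrite -(big_mkord predT (fun k => x ^+ k / k`!%:R)).
apply: (@is_cvg_vseries _ _ _ 1 (vabs x / r)); first by rewrite divr_in01 ?vabs_ge0.
by move=> k; rewrite mul1r vabs_exp_term_le.
Qed.

Lemma vexp0 : vexp (0 : K) = 1.
Proof.
(* The empty sum is 0, so the partial sums are constant only after a shift by one. *)
apply: vcvg_lim; rewrite -cvg_shiftS.
suff -> : (fun N => \sum_(0 <= k < N.+1) (0 : K) ^+ k / k`!%:R) = fun=> 1 by exact: cvg_cst.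
apply/funext => N; rewrite big_nat_recl // expr0 fact0 divr1 big1 ?addr0 // => k _.
by rewrite exprS !mul0r.
Qed.

(** By the binomial formula, the truncated series of x + y consists of the first N terms of the
    product of the two truncations; the remaining terms are at most (c/r)^N. *)
Lemma vexpD x y : vabs x < r -> vabs y < r -> vexp (x + y) = vexp x * vexp y.
Proof.
move=> xr yr; set c := Num.max (vabs x) (vabs y).
have xc : vabs x <= c by rewrite le_max lexx.
have yc : vabs y <= c by rewrite le_max lexx orbT.
have c01 : 0 <= c / r < 1 by rewrite divr_in01 ?(le_trans _ xc) ?vabs_ge0 // gt_max xr.
have [s0 s1] := andP c01.
have xyr : vabs (x + y) < r by rewrite (le_lt_trans (vabsD_max _ _)) // gt_max xr.
apply: vcvg_unique (cvg_vexp xyr) _.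
(* The powers of z sit in the coefficients and the evaluation is at 1, so that polynomial
   multiplication is the Cauchy product. *)
pose E z N : {poly K} := \poly_(i < N) (z ^+ i / i`!%:R).
have Ec z N i : vabs z <= c -> vabs ((E z N)`_i) <= 1 * (c / r) ^+ i.
  by move=> zc; rewrite coef_poly mul1r; case: ifP; rewrite ?vabs0 ?exprn_ge0 ?vabs_exp_term_le.
have E1 z N : (E z N).[1] = \sum_(k < N) z ^+ k / k`!%:R.
  by rewrite horner_poly; apply: eq_bigr => i _; rewrite expr1n mulr1.
have EM N : \sum_(k < N) (x + y) ^+ k / k`!%:R = \sum_(k < N) (E x N * E y N)`_k * 1 ^+ k.
  apply: eq_bigr => -[k /= kN] _; rewrite expr1n mulr1 coefM addrC exprDn mulr_suml.
  apply: eq_bigr => -[i /= lein] _.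
  rewrite !coef_poly (leq_ltn_trans (leq_subr _ _) kN) (leq_ltn_trans (lein : (i <= k)%N) kN).
  rewrite -mulr_natr -(bin_fact (lein : (i <= k)%N)) !natrM invfM.
  have := natr_fact_neq0 natS_neq0; move=> fK.
  have b0 : 'C(k, i)%:R != 0 :> K.
    move: (bin_gt0 k i); rewrite (lein : (i <= k)%N).
    by case: 'C(k, i) => // b _; exact: natS_neq0.
  by rewrite invfM; field; rewrite ?fK ?b0.
have := vcvgM (cvg_vexp xr) (cvg_vexp yr); under eq_fun do rewrite -!E1 -hornerM.
pose D N := \sum_(k < N) (x + y) ^+ k / k`!%:R - (E x N * E y N).[1].
move=> hM; have := @vcvgD _ _ _ D _ 0 hM.
rewrite addr0; under eq_fun do rewrite /D subrKC; apply.
apply: cvg_vabs_squeeze (cvg_geo c01) => N; rewrite subr0 vabs_distC EM.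
apply: le_trans (vabs_horner_tail (s := c / r) _ s0 _ _) _; rewrite ?vabs1 ?mulr1 ?(ltW s1) //.
move=> i; have := vabs_coefM_le (P := E x N) (Q := E y N) i s0 ler01 ler01.
by rewrite !mul1r; apply=> j; exact: Ec.
Qed.

Lemma vexpMn x n : vabs x < r -> vexp (n%:R * x) = vexp x ^+ n.
Proof.
move=> xr; elim: n => [|n IH]; first by rewrite mul0r vexp0.
rewrite -nat1r mulrDl mul1r vexpD // ?exprS ?IH //.
by rewrite (le_lt_trans _ xr) // vabsM ler_piMl ?vabs_ge0 ?vabs_nat_le1.
Qed.

(** One factor |q - 1| is kept apart from the geometric decay; it yields |log q| <= |q - 1|, which
    places log q in the disc of the exponential. *)
Lemma vabs_log_term_le q k : vabs (q - 1) < r ->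
  vabs ((-1) ^+ k * (q - 1) ^+ k.+1 / k.+1%:R) <= vabs (q - 1) * (vabs (q - 1) / r) ^+ k.
Proof.
move=> qr; rewrite !vabsM vabsV !vabsX vabsN vabs1 expr1n mul1r exprS -mulrA.
rewrite ler_wpM2l ?vabs_ge0 // expr_div_n ler_wpM2l ?exprn_ge0 ?vabs_ge0 //.
by rewrite lef_pV2 ?vabs_nat_ge // posrE ?exprn_gt0 // (lt_le_trans _ (vabs_nat_ge k)) ?exprn_gt0.
Qed.

Lemma cvg_vlog q : vabs (q - 1) < r ->
  (fun N => \sum_(0 <= k < N) (-1) ^+ k * (q - 1) ^+ k.+1 / k.+1%:R) @ \oo --> vlog q.
Proof.
move=> qr; apply: (@is_cvg_vseries _ _ _ (vabs (q - 1)) (vabs (q - 1) / r)).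
  by rewrite divr_in01 ?vabs_ge0.
by move=> k; exact: vabs_log_term_le.
Qed.

Lemma vabs_vlog_partial_le q N : vabs (q - 1) < r ->
  vabs (\sum_(0 <= k < N) (-1) ^+ k * (q - 1) ^+ k.+1 / k.+1%:R) <= vabs (q - 1).
Proof.
move=> qr; rewrite vabs_sum_le ?vabs_ge0 // => k _.
rewrite (le_trans (vabs_log_term_le k qr)) // ler_piMr ?vabs_ge0 //.
by have /andP[s0 s1] := divr_in01 (vabs_ge0 _) qr; rewrite exprn_ile1 // ltW.
Qed.

Lemma vabs_vlog_le q : vabs (q - 1) < r -> vabs (vlog q) <= vabs (q - 1).
Proof. by move=> qr; apply: vabs_lim_le (cvg_vlog qr) _ => N; exact: vabs_vlog_partial_le. Qed.

(** The logarithm has coefficients bounded by r r^(-j), so its k-th power gains a factor r^k, which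
    compensates the division by k!. *)
Lemma vabs_coef_texp_tlog1_le N i : vabs ((texp N (tlog1 (1 : K) N))`_i) <= r^-1 ^+ i.
Proof.
have r'0 : 0 <= r^-1 by rewrite invr_ge0 ltW.
have U i' : vabs ((tlog1 (1 : K) N)`_i') <= r * r^-1 ^+ i'.
  rewrite coef_poly; case: ifP => _; last by rewrite vabs0 mulr_ge0 ?exprn_ge0 // ltW.
  case: i' => [|j]; first by rewrite vabs0 mulr_ge0 ?exprn_ge0 // ltW.
  rewrite !vabsM vabsV !vabsX vabsN vabs1 !expr1n !mul1r exprS mulrA divff ?gt_eqF // mul1r exprVn.
  by rewrite lef_pV2 ?vabs_nat_ge // posrE ?exprn_gt0 // (lt_le_trans _ (vabs_nat_ge j)) ?exprn_gt0.
have Uk k j : vabs ((tlog1 (1 : K) N ^+ k)`_j) <= r ^+ k * r^-1 ^+ j.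
  elim: k j => [|k IH] j.
    rewrite expr0 coef1 expr0 mul1r; case: j => [|j]; first by rewrite vabs1 expr0.
    by rewrite vabs0 exprn_ge0.
  by rewrite !exprS vabs_coefM_le ?exprn_ge0 // ltW.
rewrite coef_sum vabs_sum_le ?exprn_ge0 // => k _; rewrite coefZ vabsM vabsV.
have f0 : 0 < vabs (k`!%:R : K) by rewrite (lt_le_trans _ (vabs_fact_ge k)) ?exprn_gt0.
rewrite mulrC ler_pdivrMr //; apply: le_trans (Uk k i) _.
by rewrite mulrC ler_wpM2l ?exprn_ge0.
Qed.

(** The truncated exponential at L = log q is compared with its value at the partial sum [LN N]. The
    latter is a polynomial in w = q - 1 whose low coefficients are those of 1 + X and whose tail is
    at most (|w|/r)^(N+1). *)
Lemma vexp_vlog q : vabs (q - 1) < r -> vexp (vlog q) = q.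
Proof.
move=> qr; set L := vlog q; set w := q - 1.
have Lr : vabs L < r by rewrite (le_lt_trans (vabs_vlog_le qr)).
have w01 := divr_in01 (vabs_ge0 w) qr; have [s0 s1] := andP w01.
pose LN N := \sum_(0 <= k < N) (-1) ^+ k * w ^+ k.+1 / k.+1%:R : K.
have LNr N : vabs (LN N) <= r by rewrite (le_trans (vabs_vlog_partial_le N qr)) // ltW.
have tLN N : (tlog1 1 N.+1).[w] = LN N.
  rewrite horner_poly big_ord_recl mul0r add0r /LN big_mkord; apply: eq_bigr => i _.
  by rewrite lift0 expr1n mulr1 mulrAC.
have texpw N : (texp N.+1 (tlog1 1 N.+1)).[w] = \sum_(k < N.+1) LN N ^+ k / k`!%:R.
  rewrite horner_sum; apply: eq_bigr => k _.
  by rewrite hornerZ horner_exp tLN mulrC.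
(* Positivity of N brings both indices 0 and 1 into the range of the sum. *)
have qE N : (0 < N)%N -> \sum_(i < N.+1) (texp N.+1 (tlog1 (1 : K) N.+1))`_i * w ^+ i = q.
  case: N => // N _.
  (* For a = z = 1 the product in [coef_texp_tlog1] contains the factor 1 - 1 as soon as i >= 2. *)
  have c i : (i < N.+2)%N -> (texp N.+2 (tlog1 (1 : K) N.+2))`_i = (i < 2)%N%:R.
    move=> iN; have := coef_texp_tlog1 natS_neq0 1 (oner_neq0 K) iN.
    rewrite divr1 scale1r => ->; case: i iN => [|[|i]] iN.
    - by rewrite big_ord0 divr1.
    - by rewrite big_ord_recl big_ord0 mul0r subr0 mulr1 divr1.
    - by rewrite 2!big_ord_recl lift0 !mulr1 subrr mul0r mulr0 mul0r.
  rewrite 2!big_ord_recl big1 => [|i _]; last by rewrite c ?ltn_ord // !lift0 mul0r.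
  by rewrite !c ?ltn_ord // lift0 expr0 expr1 !mul1r addr0 addrC subrK.
have Ecvg : (fun N => \sum_(k < N.+1) L ^+ k / k`!%:R) @ \oo --> vexp L.
  have := cvg_vexp Lr; by rewrite -cvg_shiftS.
apply: vcvg_unique Ecvg _.
have b0 : (fun N => vabs (LN N - L) / r + (vabs w / r) ^+ N.+1) @ \oo --> (0 : R).
  rewrite -[0]addr0; apply: cvgD.
    by rewrite -[0](mul0r r^-1); apply: cvgMl; apply/cvg_vabsP; exact: cvg_vlog.
  have := cvg_geo w01; by rewrite -cvg_shiftS.
apply/cvg_vabsP; apply: squeeze_cvgr (@cvg_cst _ _ _ _ _) b0.
exists 1%N => // N /= N0; rewrite vabs_ge0 /=.
rewrite -{1}(qE N N0) -(subrK (texp N.+1 (tlog1 1 N.+1)).[w] (\sum_(_ < _) L ^+ _ / _)).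
rewrite -addrA (le_trans (vabsD _ _)) // lerD //.
  rewrite texpw -sumrB vabs_sum_le ?divr_ge0 ?vabs_ge0 ?ltW // => k _.
  (* Both L and [LN N] have absolute value at most r, so the k-th powers differ by at most |L - LN|
     r^k / r, and r^k <= |k!| cancels the denominator. *)
  rewrite -mulrBl vabsM vabsV.
  have f0 : 0 < vabs (k`!%:R : K) by rewrite (lt_le_trans _ (vabs_fact_ge k)) ?exprn_gt0.
  rewrite ler_pdivrMr // (le_trans (vabs_exprB_le k r_gt0 (ltW Lr) (LNr N))) //.
  rewrite [vabs (L - _)]vabs_distC -!mulrA ler_wpM2l ?vabs_ge0 //.
  by rewrite mulrC ler_wpM2l ?invr_ge0 ?(ltW r_gt0).
have -> : vabs w / r = r^-1 * vabs w by rewrite mulrC.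
apply: vabs_horner_tail.
- by rewrite invr_ge0 ltW.
- by rewrite mulrC ltW.
exact: vabs_coef_texp_tlog1_le.
Qed.
End ExpLog.

(** * Fermionic integrals and Carlitz numbers *)

Lemma exp_affine_poly (K : comNzRingType) (c d : K) n :
  (c *: 'X + d%:P) ^+ n = \poly_(i < n.+1) ('C(n, i)%:R * c ^+ i * d ^+ (n - i)).
Proof.
rewrite poly_def addrC exprDn; apply: eq_bigr => i _.
by rewrite exprZn -rmorphXn /= mul_polyC scalerA -scaler_nat scalerA mulrA mulrAC.
Qed.

(** * Umbral evaluation and uniqueness of the Carlitz numbers *)

Section Umbral.
Variables (R : realType) (K : ultrametricFieldType R).
Implicit Types (q : K) (E : nat -> K) (P : {poly K}).

(** Frees the sum from the exact size of P, which for a power of cX + d drops when c = 0. *)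
Lemma umbral_wide E P N : (size P <= N)%N -> umbral E P = \sum_(k < N) P`_k * E k.
Proof.
move=> szP; rewrite /umbral -(subnKC szP) big_split_ord /= [X in _ + X]big1 ?addr0 // => i _.
by rewrite nth_default ?mul0r ?leq_addr.
Qed.

Lemma umbral_affine E c d n :
  umbral E ((c *: 'X + d%:P) ^+ n) =
  \sum_(k < n.+1) 'C(n, k)%:R * c ^+ k * d ^+ (n - k) * E k.
Proof.
rewrite exp_affine_poly (umbral_wide _ (size_poly _ _)).
by apply: eq_bigr => k _; rewrite coef_poly ltn_ord.
Qed.

(** Strong induction: once the earlier terms agree, the relation of index n leaves (1 + q^(n+1)) E n
    on both sides. *)
Lemma carlitz_unique q E E' : (forall n, 1 + q ^+ n != 0) ->
  is_carlitz_qEuler q E -> is_carlitz_qEuler q E' -> E = E'.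
Proof.
move=> q1 [E0 En] [E'0 E'n]; apply/funext => n.
elim/ltn_ind: n => -[|n] IH; first by rewrite E0 E'0.
have := E'n n.+1 isT; rewrite -(En n.+1 isT) -polyC1 !umbral_affine.
rewrite !(big_ord_recr n.+1) /= !mulrDr => /esym.
set A := q * \sum_(i < _) _; set B := q * \sum_(i < _) _.
have -> : A = B by congr (_ * _); apply: eq_bigr => k _; rewrite IH.
rewrite binn subnn expr0 -!addrA => /addrI e.
apply: (mulfI (q1 n.+2)).
suff eqE F : (1 + q ^+ n.+2) * F = q * (1%:R * q ^+ n.+1 * 1 * F) + F by rewrite !eqE.
by rewrite mulr1 mul1r mulrA -exprS addrC mulrDl mul1r.
Qed.
End Umbral.

(** * Fermionic integrals of polynomials in [y]_q *)

Section Fermionic.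
Variables (R : realType) (K : ultrametricFieldType R) (p : nat) (q : K).
Hypothesis p_odd : odd p.
Hypothesis vabs_p_lt1 : vabs (p%:R : K) < 1.
Hypothesis q_neq1 : q != 1.
Hypothesis q_near1 : vabs (q - 1) < 1.

(** Otherwise 1 = p - 2 (p-1)/2 would have absolute value less than 1. *)
Lemma vabs_two : vabs (2%:R : K) = 1.
Proof.
apply/le_anti; rewrite vabs_nat_le1 leNgt; apply/negP => v2.
suff : vabs (1 : K) < 1 by rewrite vabs1 ltxx.
have -> : 1 = p%:R - 2%:R * p./2%:R :> K.
  by rewrite -natrM mul2n -{1}(odd_double_half p) p_odd natrD addrK.
rewrite (le_lt_trans (vabsD_max _ _)) // gt_max vabs_p_lt1 vabsN vabsM.
by rewrite (le_lt_trans _ v2) // ler_piMr ?vabs_ge0 ?vabs_nat_le1.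
Qed.

Lemma vabs_exprq_sub1_lt1 n : vabs (q ^+ n - 1) < 1.
Proof. by rewrite (le_lt_trans _ q_near1) // vabs_expr_sub1_le // ltW. Qed.

Lemma addr1_exprq_neq0 n : 1 + q ^+ n != 0.
Proof.
rewrite -vabs_gt0 (@vabs_dominant _ _ _ 2%:R) vabs_two //.
have -> : 1 + q ^+ n - 2%:R = q ^+ n - 1 by ring.
by rewrite ?vabs_two vabs_exprq_sub1_lt1.
Qed.

(** Each p-th power multiplies Q - 1 by 1 + Q + ... + Q^(p-1), which is p plus terms Q^i - 1, hence
    at most s = max(|Q - 1|, |p|). *)
Lemma cvg_expr_exp (Q : K) : vabs (Q - 1) < 1 -> (fun N => Q ^+ (p ^ N)) @ \oo --> (1 : K).
Proof.
move=> Q1; set s := Num.max (vabs (Q - 1)) (vabs (p%:R : K)).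
have Qs : vabs (Q - 1) <= s by rewrite le_max lexx.
have ps : vabs (p%:R : K) <= s by rewrite le_max lexx orbT.
have s01 : 0 <= s < 1 by rewrite (le_trans _ Qs) ?vabs_ge0 // gt_max Q1.
have [s0 s1] := andP s01.
apply: cvg_vabs_squeeze (cvg_geo s01) => N.
apply: (@le_trans _ _ (s ^+ N.+1)); last by rewrite ler_wiXn2l // ltW.
elim: N => [|N IH]; first by rewrite expn0 !expr1.
rewrite expnSr exprM subrX1 vabsM mulrC [s ^+ _]exprS ler_pM ?vabs_ge0 //.
have -> : \sum_(i < p) Q ^+ (p ^ N) ^+ i =
          \sum_(i < p) (Q ^+ (p ^ N) ^+ i - 1) + p%:R.
  by rewrite sumrB sumr_const card_ord subrK.
apply: vabsD_le => //; apply: vabs_sum_le => // i _.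
by rewrite vabs_expr_sub1_le ?(ltW s1) // vabs_expr_sub1_le ?(ltW s1).
Qed.

(** A convergence statement, unlike the value of [lim], passes through sums and multiples without a
    separate existence proof. *)
Definition fermionic_cvg (f : nat -> K) (l : K) :=
  (fun N => (qnumN q (p ^ N))^-1 * \sum_(0 <= y < p ^ N) f y * (- q) ^+ y) @ \oo --> l.

Lemma fermionic_cvg_int (f : K -> K) l :
  fermionic_cvg (fun y => f y%:R) l -> fermionic_int p q f = l.
Proof. exact: vcvg_lim. Qed.

Lemma fermionic_cvgZ f l c : fermionic_cvg f l -> fermionic_cvg (fun y => c * f y) (c * l).
Proof.
move=> fl; apply: vcvg_ext (vcvgM (@cvg_cst _ c _ _ _) fl) => N /=.
rewrite mulrCA; congr (_ * _); rewrite mulr_sumr; apply: eq_bigr => y _; exact: mulrA.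
Qed.

Lemma fermionic_cvg_sum (I : Type) (s : seq I) (F : I -> nat -> K) (l : I -> K) :
  (forall i, fermionic_cvg (F i) (l i)) ->
  fermionic_cvg (fun y => \sum_(i <- s) F i y) (\sum_(i <- s) l i).
Proof.
move=> Fl; apply: vcvg_ext (vcvg_sum (s := s) (P := predT) (fun i _ => Fl i)) => N /=.
rewrite -mulr_sumr exchange_big; congr (_ * _); apply: eq_bigr => y _.
by rewrite mulr_suml.
Qed.

Lemma exprNq_pX N (Q : K) : (- Q) ^+ (p ^ N) = - Q ^+ (p ^ N).
Proof. by rewrite exprNn -signr_odd oddX p_odd orbT mulN1r. Qed.

Lemma cvg_qnumN_inv : (fun N => (qnumN q (p ^ N))^-1) @ \oo --> (1 + q) / 2%:R.
Proof.
have two0 : 2%:R != 0 :> K by rewrite -vabs_gt0 vabs_two.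
have -> : (fun N => (qnumN q (p ^ N))^-1) = fun N => (1 + q) * (1 + q ^+ (p ^ N))^-1.
  by apply/funext => N; rewrite /qnumN exprNq_pX opprK invfM invrK mulrC.
apply: vcvgM; first exact: cvg_cst.
apply: vcvgV => //; apply: vcvgD; [exact: cvg_cst | exact: cvg_expr_exp].
Qed.

(** The sum is geometric of ratio -q^(l+1) with an odd number of terms; its numerator tends to 2,
    which cancels the 2 in the limit of 1/[p^N]_{-q}. *)
Lemma fermionic_cvg_expr l :
  fermionic_cvg (fun y => (q ^+ l) ^+ y) ((1 + q) / (1 + q ^+ l.+1)).
Proof.
have two0 : 2%:R != 0 :> K by rewrite -vabs_gt0 vabs_two.
have l0 := addr1_exprq_neq0 l.+1.
have -> : (1 + q) / (1 + q ^+ l.+1) = (1 + q) / 2%:R * ((1 + 1) * (1 + q ^+ l.+1)^-1).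
  by rewrite -[1 + 1]/(2%:R : K) mulrA divfK.
apply: vcvgM; first exact: cvg_qnumN_inv.
have -> : (fun N => \sum_(0 <= y < p ^ N) (q ^+ l) ^+ y * (- q) ^+ y) =
          fun N => (1 + (q ^+ l.+1) ^+ (p ^ N)) * (1 + q ^+ l.+1)^-1.
  apply/funext => N; apply: (mulIf l0); rewrite mulfVK // big_mkord.
  under eq_bigr do rewrite -exprMn mulrN -exprSr.
  have := subrX1 (- q ^+ l.+1) (p ^ N); rewrite exprNq_pX => e.
  by rewrite -[RHS]opprK opprD [- 1 - _]addrC e; ring.
apply: vcvgM; last exact: cvg_cst.
apply: vcvgD; [exact: cvg_cst | apply: cvg_expr_exp; exact: vabs_exprq_sub1_lt1].
Qed.

(** [y]_q with an ordinary power: the arguments of this section need only |q - 1| < 1 and neither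
    exp nor log. *)
Definition qnat (y : nat) : K := (1 - q ^+ y) / (1 - q).

(** The moments of [y]_q, read off from the binomial expansion of (1 - q^y)^n. *)
Definition qEuler_closed n : K :=
  (1 - q)^-1 ^+ n * \sum_(l < n.+1) (-1) ^+ l * 'C(n, l)%:R * ((1 + q) / (1 + q ^+ l.+1)).

Lemma fermionic_cvg_qnatX n : fermionic_cvg (fun y => qnat y ^+ n) (qEuler_closed n).
Proof.
have -> : (fun y => qnat y ^+ n) = fun y =>
    (1 - q)^-1 ^+ n * \sum_(l < n.+1) (-1) ^+ l * 'C(n, l)%:R * (q ^+ l) ^+ y.
  apply/funext => y; rewrite /qnat exprMn mulrC exprDn; congr (_ * _).
  apply: eq_bigr => l _; rewrite expr1n mul1r -mulr_natr [(- q ^+ y) ^+ l]exprNn.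
  by rewrite -!exprM mulnC mulrAC.
apply: fermionic_cvgZ; apply: fermionic_cvg_sum => l; apply: fermionic_cvgZ.
exact: fermionic_cvg_expr.
Qed.

Lemma fermionic_cvg_horner (P : {poly K}) :
  fermionic_cvg (fun y => P.[qnat y]) (umbral qEuler_closed P).
Proof.
rewrite /umbral; under eq_fun do rewrite horner_coef.
apply: fermionic_cvg_sum => i; apply: fermionic_cvgZ; exact: fermionic_cvg_qnatX.
Qed.

Lemma qnatS y : qnat y.+1 = q * qnat y + 1.
Proof.
have q1 : 1 - q != 0 by rewrite subr_eq0 eq_sym.
by rewrite /qnat exprS; field.
Qed.

(** Telescoping, since q (-q)^y = -(-q)^(y+1); the lower boundary term vanishes because [0]_q = 0
    and n > 0. *)
Lemma qnat_shift_sum n M : (0 < n)%N ->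
  q * \sum_(0 <= y < M) qnat y.+1 ^+ n * (- q) ^+ y +
  \sum_(0 <= y < M) qnat y ^+ n * (- q) ^+ y = - (qnat M ^+ n * (- q) ^+ M).
Proof.
move=> n0; elim: M => [|M IH].
  by rewrite !big_geq // mulr0 addr0 /qnat expr0 subrr mul0r expr0n gtn_eqF // mul0r oppr0.
by rewrite !big_nat_recr //= mulrDr addrACA IH exprS; ring.
Qed.

Lemma cvg_qnat_pX : (fun N => qnat (p ^ N)) @ \oo --> (0 : K).
Proof.
rewrite -(mul0r (1 - q)^-1) -(subrr (1 : K)); apply: vcvgM; last exact: cvg_cst.
have -> : (fun N => 1 - q ^+ (p ^ N)) = fun N => 1 + (-1) * q ^+ (p ^ N).
  by apply/funext => N; rewrite mulN1r.
apply: vcvgD; first exact: cvg_cst.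
rewrite -[X in _ --> X]mulr1; apply: vcvgM; [exact: cvg_cst | exact: cvg_expr_exp].
Qed.

(** Integrating [y+1]_q = q [y]_q + 1 to the power n leaves only the boundary term of the
    telescoping sum, which tends to 0 with [p^N]_q. *)
Lemma qEuler_closed_carlitz : is_carlitz_qEuler q qEuler_closed.
Proof.
split=> [|n n0].
  rewrite /qEuler_closed big_ord1 bin0 !expr0 !mul1r expr1 divff //.
  by have := addr1_exprq_neq0 1; rewrite expr1.
have h1 := fermionic_cvgZ (c := q) (fermionic_cvg_horner (P := (q *: 'X + 1) ^+ n)).
have := vcvgD h1 (fermionic_cvg_qnatX (n := n)) => h2; apply: vcvg_unique h2 _.
set F := fun N => _; have -> : (0 : K) = (1 + q) / 2%:R * (0 * 1) by rewrite mul0r mulr0.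
have {F}-> : F = fun N => (qnumN q (p ^ N))^-1 * (qnat (p ^ N) ^+ n * q ^+ (p ^ N)).
  apply/funext => N; rewrite /F -mulrDr; congr (_ * _).
  (* The oddness of p^N turns q^(p^N) into -(-q)^(p^N), the sign of the boundary term. *)
  rewrite -[RHS]opprK -mulrN -exprNq_pX -(qnat_shift_sum _ n0) mulr_sumr.
  congr (_ + _); apply: eq_bigr => y _.
  by rewrite horner_exp !hornerE qnatS mulrA.
apply: vcvgM; first exact: cvg_qnumN_inv.
apply: vcvgM; last exact: cvg_expr_exp.
have -> : (0 : K) = 0 ^+ n by rewrite expr0n gtn_eqF.
elim: (n) => [|m IH].
  by under eq_fun do rewrite expr0; rewrite expr0; exact: cvg_cst.
under eq_fun do rewrite exprS; rewrite exprS.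
by apply: vcvgM => //; exact: cvg_qnat_pX.
Qed.

Lemma qEuler_closedE : qEuler q = qEuler_closed.
Proof.
apply: get_unique; first exact: qEuler_closed_carlitz.
by move=> E cE; apply: carlitz_unique cE qEuler_closed_carlitz; exact: addr1_exprq_neq0.
Qed.
End Fermionic.

(** * The p-adic absolute value *)

(** With v the valuation, Bernoulli's inequality gives 1 + (p-1) v <= p^v <= n + 1. *)
Lemma logn_le_pred p n : prime p -> (p.-1 * logn p n.+1 <= n)%N.
Proof.
move=> p_pr; rewrite -ltnS; apply: leq_trans (dvdn_leq (ltn0Sn n) (pfactor_dvdnn p n.+1)).
have p1 := prime_gt1 p_pr; elim: (logn _ _) => [|v IH]; first by rewrite muln0 expn0.
rewrite mulnS expnS; have := expn_gt0 p v; nia.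
Qed.

(** Legendre's formula, with the floors summed by induction. *)
Lemma logn_fact_le p n : prime p -> (p.-1 * logn p n`! <= n)%N.
Proof.
move=> p_pr; rewrite logn_fact // big_add1 /=.
(* The extra term pays for the next one: p times the floor of n/p^(m+1) is at most the floor of
   n/p^m. *)
suff H m : (p.-1 * (\sum_(0 <= k < m) n %/ p ^ k.+1) + n %/ p ^ m <= n)%N.
  exact: leq_trans (leq_addr _ _) (H n).
have p0 := prime_gt0 p_pr; elim: m => [|m IH]; first by rewrite big_geq // muln0 expn0 divn1.
rewrite big_nat_recr //= expnSr divnMA; apply: leq_trans IH.
rewrite mulnDr -addnA leq_add2l -mulSnr prednK // mulnC; exact: leq_trunc_div.
Qed.

Section PadicAbs.
Variables (R : realType) (p : nat) (K : padicComplexType R p).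
Hypothesis p_pr : prime p.

Lemma vabs_p_lt1 : vabs (p%:R : K) < 1.
Proof. by rewrite vabs_p invf_lt1 ?ltr0n ?prime_gt0 // ltr1n prime_gt1. Qed.

(** A Bezout relation between p and m would otherwise give |1| < 1. *)
Lemma vabs_coprime m : coprime p m -> vabs (m%:R : K) = 1.
Proof.
move=> pm; apply/le_anti; rewrite vabs_nat_le1 leNgt; apply/negP => m1.
have [u v uv _] := egcdnP m (prime_gt0 p_pr).
suff : vabs (1 : K) < 1 by rewrite vabs1 ltxx.
have -> : 1 = u%:R * p%:R - v%:R * m%:R :> K.
  by rewrite -!natrM uv (eqP pm) natrD addrAC subrr add0r.
rewrite (le_lt_trans (vabsD_max _ _)) // gt_max vabsN !vabsM.
by rewrite (le_lt_trans _ vabs_p_lt1) ?(le_lt_trans _ m1) // ler_piMl ?vabs_ge0 ?vabs_nat_le1.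
Qed.

Lemma vabs_natE n : (0 < n)%N -> vabs (n%:R : K) = p%:R^-1 ^+ logn p n.
Proof.
move=> n0; have [m pm {1}->] := pfactor_coprime p_pr n0.
by rewrite natrM natrX vabsM vabs_coprime // mul1r vabsX vabs_p.
Qed.

Lemma vabs_nat_ge_exp (r : R) n v : 0 <= r <= 1 -> r ^+ p.-1 = p%:R^-1 ->
  (0 < n)%N -> (p.-1 * logn p n <= v)%N -> r ^+ v <= vabs (n%:R : K).
Proof.
move=> /andP[r0 r1] rp n0 nv; rewrite vabs_natE // -rp -exprM.
by rewrite ler_wiXn2l.
Qed.
End PadicAbs.

(** The radius of convergence of the p-adic exponential. *)
Definition padic_radius (R : realType) (p : nat) : R := p%:R `^ (- (p.-1%:R)^-1).

Lemma padic_radius_gt0 (R : realType) p : prime p -> 0 < padic_radius R p.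
Proof. by move=> p_pr; rewrite powR_gt0 // ltr0n prime_gt0. Qed.

Lemma padic_radiusX (R : realType) p : prime p -> padic_radius R p ^+ p.-1 = p%:R^-1.
Proof.
move=> p_pr; rewrite -powR_mulrn ?powR_ge0 // -powRrM mulNr mulVf ?powRN ?powRr1 ?ler0n //.
by rewrite pnatr_eq0 -lt0n -ltnS prednK ?prime_gt1 ?prime_gt0.
Qed.

Lemma padic_radius_lt1 (R : realType) p : prime p -> padic_radius R p < 1.
Proof.
move=> p_pr; rewrite ltNge; apply/negP => r1.
have := exprn_ege1 p.-1 r1; rewrite padic_radiusX // leNgt invf_lt1 ?ltr0n ?prime_gt0 //.
by rewrite ltr1n prime_gt1.
Qed.

Theorem theorem2p1 (R : realType) (p : nat) (Cp : padicComplexType R p)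
    (p_prime : prime p) (p_odd : odd p)
    (q lambda x : Cp) (q_neq1 : q != 1)
    (q_near1 : vabs (q - 1) < (p%:R : R) `^ (- (p.-1%:R)^-1))
    (lambda_neq0 : lambda != 0) (x_le1 : vabs x <= 1) (n : nat) :
  degenerate_qEuler p n q x lambda =
  \sum_(m < n.+1) lambda ^+ (n - m) * qEuler_poly m q x * (stirling1 n m)%:~R.
Proof.
set r := padic_radius R p.
have r0 : 0 < r by exact: padic_radius_gt0.
have r1 : r < 1 by exact: padic_radius_lt1.
have rp : r ^+ p.-1 = p%:R^-1 by exact: padic_radiusX.
have r01 : 0 <= r <= 1 by rewrite !ltW.
have nat_ge k : r ^+ k <= vabs (k.+1%:R : Cp).
  by apply: vabs_nat_ge_exp => //; exact: logn_le_pred.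
have fact_ge k : r ^+ k <= vabs (k`!%:R : Cp).
  by apply: vabs_nat_ge_exp => //; [exact: fact_gt0 | exact: logn_fact_le].
have natK := natS_neq0 r0 nat_ge.
have p1 := vabs_p_lt1 Cp p_prime.
have q1 : vabs (q - 1) < 1 by exact: lt_trans q_near1 r1.
have Lr : vabs (vlog q) < r by exact: le_lt_trans (vabs_vlog_le r0 nat_ge q_near1) q_near1.
have xLr : vabs (x * vlog q) < r.
  by rewrite (le_lt_trans _ Lr) // vabsM ler_piMl ?vabs_ge0.
have qnum_add y : qnum q (x + y%:R) = qpow q x * qnat q y + qnum q x.
  rewrite /qnum /qpow [(x + _) * _]mulrDl (vexpD r0 nat_ge fact_ge) //; last first.
    by rewrite (le_lt_trans _ Lr) // vabsM ler_piMl ?vabs_ge0 ?vabs_nat_le1.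
  rewrite (vexpMn r0 nat_ge fact_ge) // (vexp_vlog r0 nat_ge fact_ge) //.
  by rewrite /qnat; field; rewrite subr_eq0 eq_sym.
(* The defining sum of [qEuler_poly] is the umbral expansion of (q^x X + [x]_q)^m, because q^(lx) =
   (q^x)^l. *)
have qEuler_polyE m :
    umbral (qEuler_closed q) ((qpow q x *: 'X + (qnum q x)%:P) ^+ m) = qEuler_poly m q x.
  rewrite umbral_affine /qEuler_poly (qEuler_closedE p_odd) //; apply: eq_bigr => l _.
  by rewrite /qpow -[_ * x * _]mulrA (vexpMn r0 nat_ge fact_ge) // mulrAC.
have fact0 : n`!%:R != 0 :> Cp by exact: natr_fact_neq0.
rewrite /degenerate_qEuler.
set I := \sum_(m < _) _.
rewrite (fermionic_cvg_int (l := n`!%:R^-1 * I)) ?mulVKf //.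
(* The integrand becomes a polynomial in [y]_q, to which the umbral formula applies term by term. *)
have -> : (fun y => degenerate_exp lambda (qnum q (x + y%:R)) n) = fun y => n`!%:R^-1 *
    \sum_(m < n.+1) (lambda ^+ (n - m) * (stirling1 n m)%:~R *
      ((qpow q x *: 'X + (qnum q x)%:P) ^+ m).[qnat q y]).
  apply/funext => y; rewrite (degenerate_expE natK) // prod_stirling1 // mulrC.
  congr (_ * _); apply: eq_bigr => m _.
  by rewrite qnum_add horner_exp !hornerE mulrAC.
apply: fermionic_cvgZ; rewrite /I.
under [X in fermionic_cvg _ _ _ X]eq_bigr do rewrite mulrAC -qEuler_polyE.
apply: fermionic_cvg_sum => m; apply: fermionic_cvgZ.
exact: fermionic_cvg_horner.
Qed.
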